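(* For any integer $k\geq 1$, every graph of cliquewidth at most $k$ is $3$-quasi-isometric to a graph of treewidth at most $k-1$.
   Context: Graphs are finite and simple. For a graph $G$, $\mathrm{dist}_G(u,v)$ is the length (number of edges) of a shortest $u$–$v$ path, or $\infty$ if none exists. For a real $c>0$ and graphs $G,H$, a map $f:V(G)\to V(H)$ is a $c$-quasi-isometry from $G$ to $H$ if (QI1) for all $x,y\in V(G)$, $\mathrm{dist}_G(x,y)/c-c\leq \mathrm{dist}_H(f(x),f(y))\leq c\,\mathrm{dist}_G(x,y)+c$, and (QI2) for every $z\in V(H)$ there is $v\in V(G)$ with $\mathrm{dist}_H(z,f(v))\leq c$. $G$ is $c$-quasi-isometric to $H$ if such a map exists. Cliquewidth: a colouring of $G$ with colours $\{1,\dots,k\}$ is a map $c:V(G)\to\{1,\dots,k\}$; a colour $i$ is used by $c$ if $c^{-1}(i)\neq\emptyset$. A pair $(G,c)$ is a cliquewidth-$k$ pair if $|V(G)|\leq 1$, or at least one of the following holds: (OP1) there are cliquewidth-$k$ pairs $(G_1,c_1),(G_2,c_2)$ with $G_1,G_2$ nonempty, $G$ the disjoint union of $G_1$ and $G_2$, and $c$ agreeing with $c_1$ on $V(G_1)$ and with $c_2$ on $V(G_2)$; (OP2) there are a colouring $c'$ of $G$ and distinct $i,j\in\{1,\dots,k\}$ such that $(G,c')$ is a cliquewidth-$k$ pair, $i,j$ are both used by $c'$, and $c$ is obtained from $c'$ by changing the colour of every vertex coloured $i$ to $j$; (OP3) there are a proper subgraph $G'$ of $G$ with $V(G')=V(G)$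 and distinct $i,j\in\{1,\dots,k\}$ such that $(G',c)$ is a cliquewidth-$k$ pair and $G$ is obtained from $G'$ by adding an edge between every pair of non-adjacent vertices $u,v$ with $u$ coloured $i$ and $v$ coloured $j$. The cliquewidth of $G$ is the minimum $k$ such that there is a colouring $c$ of $G$ with colours $\{1,\dots,k\}$ for which $(G,c)$ is a cliquewidth-$k$ pair. Treewidth: a tree-decomposition of $G$ is a tree $T$ with sets (bags) $B_t\subseteq V(G)$, $t\in V(T)$, such that for each $v\in V(G)$ the set $\{t: v\in B_t\}$ induces a nonempty subtree of $T$, and each edge of $G$ has both ends in some bag. Its width is the maximum bag size minus 1; the treewidth of $G$ is the minimum width of a tree-decomposition. *)

(* Defs.v *)
From mathcomp Require Import all_boot all_order all_algebra.
From mathcomp Require Import boolp reals constructive_ereal.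

Set Implicit Arguments.
Unset Strict Implicit.
Unset Printing Implicit Defensive.

Import Order.TTheory GRing.Theory Num.Theory.

Record sgraph (V : finType) := SGraph {
  adj :> rel V;
  adj_sym : symmetric adj;
  adj_irrefl : irreflexive adj }.

(* [p] lists the vertices of the path after [u], so its length is [size p]. *)
Definition is_path (V : finType) (G : sgraph V) (u v : V) (p : seq V) : bool :=
  [&& path G u p, last u p == v & uniq (u :: p)].

Definition has_path_of_length (V : finType) (G : sgraph V) (u v : V) (n : nat)
  : bool := [exists p : n.-tuple V, is_path G u v p].

Definition dist (R : realType) (V : finType) (G : sgraph V) (u v : V) : \bar R :=
  match pselect (exists n, has_path_of_length G u v n) with
  | left h => ((ex_minn h)%:R)%:E
  | right _ => +oo%E
  end.

(* Meant for [0 < c]. *)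
Definition quasi_isometry (R : realType) (c : R) (V W : finType)
    (G : sgraph V) (H : sgraph W) (f : V -> W) : Prop :=
  (forall x y : V,
     (dist R G x y * (c^-1)%:E - c%:E <= dist R H (f x) (f y))%E /\
     (dist R H (f x) (f y) <= c%:E * dist R G x y + c%:E)%E) /\
  (forall z : W, exists v : V, (dist R H z (f v) <= c%:E)%E).

Definition quasi_isometric (R : realType) (c : R) (V W : finType)
    (G : sgraph V) (H : sgraph W) : Prop :=
  exists f : V -> W, quasi_isometry c G H f.

Section DisjointUnion.
Variables (V1 V2 : finType) (G1 : sgraph V1) (G2 : sgraph V2).

Definition dunion_adj : rel (V1 + V2)%type := fun x y =>
  match x, y with
  | inl a, inl b => G1 a b
  | inr a, inr b => G2 a b
  | _, _ => false
  end.

Lemma dunion_sym : symmetric dunion_adj.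
Proof. by move=> [a|a] [b|b] //=; rewrite adj_sym. Qed.

Lemma dunion_irrefl : irreflexive dunion_adj.
Proof. by move=> [a|a] /=; rewrite adj_irrefl. Qed.

Definition dunion : sgraph (V1 + V2)%type := SGraph dunion_sym dunion_irrefl.
End DisjointUnion.

Definition graph_iso (V W : finType) (G : sgraph V) (H : sgraph W) (h : V -> W)
  : Prop := bijective h /\ forall x y, H (h x) (h y) = G x y.

Definition proper_spanning_subgraph (V : finType) (G' G : sgraph V) : Prop :=
  (forall u v, G' u v -> G u v) /\ (exists u v, G u v && ~~ G' u v).

Definition colour_used (k : nat) (V : finType) (c : V -> 'I_k) (i : 'I_k) : Prop :=
  exists v, c v = i.

(* Disjoint unions are taken up to the isomorphism [h], since the vertex sets
   of the parts are types of their own. *)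
Inductive cliquewidth_pair (k : nat) :
    forall V : finType, sgraph V -> (V -> 'I_k) -> Prop :=
| cw_small (V : finType) (G : sgraph V) (c : V -> 'I_k) :
    #|V| <= 1 -> cliquewidth_pair G c
| cw_union (V V1 V2 : finType) (G : sgraph V) (c : V -> 'I_k)
    (G1 : sgraph V1) (c1 : V1 -> 'I_k) (G2 : sgraph V2) (c2 : V2 -> 'I_k)
    (h : V1 + V2 -> V) :
    cliquewidth_pair G1 c1 -> cliquewidth_pair G2 c2 ->
    0 < #|V1| -> 0 < #|V2| ->
    graph_iso (dunion G1 G2) G h ->
    (forall x, c (h (inl x)) = c1 x) -> (forall x, c (h (inr x)) = c2 x) ->
    cliquewidth_pair G c
| cw_recolour (V : finType) (G : sgraph V) (c c' : V -> 'I_k) (i j : 'I_k) :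
    i != j -> cliquewidth_pair G c' ->
    colour_used c' i -> colour_used c' j ->
    (forall v, c v = if c' v == i then j else c' v) ->
    cliquewidth_pair G c
| cw_join (V : finType) (G G' : sgraph V) (c : V -> 'I_k) (i j : 'I_k) :
    i != j -> cliquewidth_pair G' c ->
    proper_spanning_subgraph G' G ->
    (forall u v, G u v = [|| G' u v, (c u == i) && (c v == j)
                                   | (c u == j) && (c v == i)]) ->
    cliquewidth_pair G c.

Definition has_cliquewidth_colouring (V : finType) (G : sgraph V) (k : nat) : Prop :=
  exists c : V -> 'I_k, cliquewidth_pair G c.

Lemma cliquewidth_pair_edgeless (k : nat) (V : finType) (G : sgraph V)
    (c : V -> 'I_k) :
  (forall u v, G u v = false) -> cliquewidth_pair G c.
Proof.
move: {2}#|V| (leqnn #|V|) => n.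
elim: n V G c => [|n IHn] V G c leVn G0; first by apply: cw_small; rewrite (leq_trans leVn).
have [/cw_small|V_gt1] := leqP #|V| 1; first exact.
have /card_gt0P[x _] := ltnW V_gt1.
pose P y := y == x.
pose V1 : finType := {y : V | P y}; pose V2 : finType := {y : V | ~~ P y}.
pose E W : sgraph W :=
  @SGraph W (fun _ _ => false) (fun _ _ => erefl) (fun _ => erefl).
have cV1 : #|V1| = 1 by rewrite card_sig (eq_card1 (x := x)).
have cV2 : #|V2| = #|V|.-1.
  rewrite card_sig -(cardC (pred1 x)) card1 add1n /=.
  by apply: eq_card => y; rewrite !inE.
pose h (u : V1 + V2) : V := match u with inl a => val a | inr a => val a end.
apply: (@cw_union k V V1 V2 G c (E V1) (c \o val) (E V2) (c \o val) h) => //.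
- apply: cw_small. by rewrite cV1.
- by apply: IHn => //; rewrite cV2 -ltnS prednK // ltnW.
- by rewrite cV1.
- by rewrite cV2 -subn1 subn_gt0.
split; last by move=> [a|a] [b|b]; rewrite G0.
apply: inj_card_bij; last by rewrite card_sum cV1 cV2 add1n prednK // ltnW.
move=> [[a Pa]|[a Pa]] [[b Pb]|[b Pb]] /= eq_ab.
- by congr inl; apply: val_inj.
- by case/negP: (Pb); rewrite -eq_ab.
- by case/negP: (Pa); rewrite eq_ab.
- by congr inr; apply: val_inj.
Qed.

Lemma cliquewidth_pair_inj (k : nat) (V : finType) (G : sgraph V)
    (c : V -> 'I_k) :
  injective c -> cliquewidth_pair G c.
Proof.
move=> c_inj; pose edges (H : sgraph V) := #|[pred e : V * V | H e.1 e.2]|.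
move: {2}(edges G) (leqnn (edges G)) => n.
elim: n G => [|n IHn] G leGn.
  apply: cliquewidth_pair_edgeless => u v.
  have /card0_eq/(_ (u, v)) : edges G = 0 by apply/eqP; rewrite -leqn0.
  by rewrite inE.
case: (pickP [pred e : V * V | G e.1 e.2]) => [[u v] /= Guv|G0]; last first.
  by apply: cliquewidth_pair_edgeless => u v; apply: (G0 (u, v)).
pose B a b := (a == u) && (b == v) || (a == v) && (b == u).
have BC a b : B a b = B b a by rewrite /B orbC ![(b == _) && _]andbC.
pose e' a b := G a b && ~~ B a b.
have e'_sym : symmetric e' by move=> a b; rewrite /e' adj_sym BC.
have e'_irr : irreflexive e' by move=> a; rewrite /e' adj_irrefl.
pose G' := SGraph e'_sym e'_irr.
have Buv : B u v by rewrite /B !eqxx.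
have uNv : c u != c v.
  by apply/eqP => /c_inj eq_uv; move: Guv; rewrite eq_uv adj_irrefl.
apply: (@cw_join k V G G' c (c u) (c v) uNv).
- apply: IHn; rewrite -ltnS (leq_trans _ leGn) //; apply: proper_card.
  apply/properP; split; first by apply/subsetP => -[a b]; rewrite !inE => /andP[].
  by exists (u, v); rewrite !inE //= /e' Buv andbF.
- split; first by move=> a b /andP[].
  by exists u, v; rewrite /= /e' Guv Buv.
move=> a b; rewrite /= /e' !(inj_eq c_inj) -/(B a b).
case: (boolP (B a b)) => [|_]; last by rewrite andbT orbF.
rewrite orbT; case/orP => /andP[/eqP-> /eqP->] //.
by rewrite adj_sym.
Qed.

Lemma cliquewidth_exists (V : finType) (G : sgraph V) :
  exists k, `[< has_cliquewidth_colouring G k >].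
Proof.
exists #|V|; apply/asboolP; exists enum_rank.
exact/cliquewidth_pair_inj/enum_rank_inj.
Qed.

Definition cliquewidth (V : finType) (G : sgraph V) : nat :=
  ex_minn (cliquewidth_exists G).

Section Induced.
Variables (V : finType) (G : sgraph V) (A : {set V}).

Definition induced_adj : rel {x : V | x \in A} := fun x y => G (val x) (val y).

Lemma induced_sym : symmetric induced_adj.
Proof. by move=> x y; apply: adj_sym. Qed.

Lemma induced_irrefl : irreflexive induced_adj.
Proof. by move=> x; apply: adj_irrefl. Qed.

Definition induced : sgraph {x : V | x \in A} := SGraph induced_sym induced_irrefl.
End Induced.

(* The null graph is not a tree. *)
Definition is_tree (V : finType) (G : sgraph V) : Prop :=
  [/\ 0 < #|V|,
      forall x y, connect G x y
    & forall p : seq V, 2 < size p -> ~ ucycle G p].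

Definition tree_decomposition (V I : finType) (G : sgraph V) (T : sgraph I)
    (B : I -> {set V}) : Prop :=
  [/\ is_tree T,
      forall v, is_tree (induced T [set t | v \in B t])
    & forall u v, G u v -> exists t, (u \in B t) && (v \in B t)].

Definition max_bag_size (V I : finType) (B : I -> {set V}) : nat :=
  \max_(t : I) #|B t|.

Definition has_max_bag_size (V : finType) (G : sgraph V) (n : nat) : Prop :=
  exists (I : finType) (T : sgraph I) (B : I -> {set V}),
    tree_decomposition G T B /\ max_bag_size B = n.

Lemma tree_decomposition_exists (V : finType) (G : sgraph V) :
  exists n, `[< has_max_bag_size G n >].
Proof.
pose E W : sgraph W :=
  @SGraph W (fun _ _ => false) (fun _ _ => erefl) (fun _ => erefl).
pose B (_ : unit) := [set: V].
exists (max_bag_size B); apply/asboolP; exists unit, (E unit), B; split=> //; split.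
- split; [by rewrite card_unit | by move=> [] [] |].
  by move=> [|[] [|[] p]].
- move=> v; have tt_in : tt \in [set t | v \in B t] by rewrite !inE.
  split; first by apply/card_gt0P; exists (Sub tt tt_in).
    by move=> [[] x] [[] y]; rewrite (bool_irrelevance x y).
  by move=> [|a [|b p]] //= _ /andP[].
- by move=> u v _; exists tt; rewrite !inE.
Qed.

(* The least width is the least maximum bag size minus 1. It is an [int], as the
   null graph has treewidth [-1]. *)
Definition treewidth (V : finType) (G : sgraph V) : int :=
  ((ex_minn (tree_decomposition_exists G))%:Z - 1)%R.

(* Main.v *)
(* Call a colour class arising while G is built active if it receives further
   edges later on. An active class stays inside a class, and at its last join
   its vertices acquire a common neighbour in G. Identify two vertices when they
   lie together in an active class at some stage. The vertices of the quotient H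
   then have weak diameter at most 2 in G, so a path of length n in H lifts to
   one of length at most 3n + 2 in G. Along the tree of the construction, the
   active classes at each stage form a bag of at most k vertices of H, and these
   bags are a tree-decomposition of H. *)
Require Import Defs.
From mathcomp Require Import all_boot all_order all_algebra.
From mathcomp Require Import boolp reals constructive_ereal.
From mathcomp Require Import lra.

Set Implicit Arguments.
Unset Strict Implicit.
Unset Printing Implicit Defensive.

Import Order.TTheory GRing.Theory Num.Theory.

(** * Rooted trees described by ranks and parent maps *)

(** Descending in rank connects every vertex to [q]. A vertex of maximum rank on a cycle would have
    two distinct neighbours of rank at most its own, which the second hypothesis forbids. *)
Lemma ranked_is_tree (J : finType) (T : sgraph J) (rk : J -> nat) (q : J) :
  (forall t, t != q -> exists s, T t s && (rk s < rk t)) ->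
  (forall t s s', T t s -> T t s' -> rk s <= rk t -> rk s' <= rk t -> s = s') ->
  is_tree T.
Proof.
move=> down uniq_down.
have to_q t : connect T t q.
  move: {2}(rk t) (leqnn (rk t)) => n; elim: n t => [|n IHn] t le_t_n.
    have [->|/down[s /andP[_]]] := eqVneq t q; first exact: connect0.
    by rewrite ltnNge (leq_trans le_t_n).
  have [->|/down[s /andP[Tts lt_st]]] := eqVneq t q; first exact: connect0.
  apply: connect_trans (connect1 Tts) (IHn s _).
  by rewrite -ltnS (leq_trans lt_st).
split; first by apply/card_gt0P; exists q.
  move=> x y; apply: connect_trans (to_q x) _.
  by rewrite (sym_connect_sym (@adj_sym _ T)).
move=> c c_gt2 Tc.
have [x0 cx0] : exists x0, x0 \in c.
  by case: c c_gt2 {Tc} => // x0 c _; exists x0; rewrite mem_head.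
case: (arg_maxnP rk cx0) => x cx x_max.
(* Rotating the cycle to start at [x] turns the two cycle-neighbours of [x] into the second and the
   last entries, [a] and [b]. *)
have [i c' def_c'] := rot_to cx.
have: ucycle T (rot i c) by rewrite rot_ucycle.
have: 2 < size (rot i c) by rewrite size_rot.
have rk_le y : y \in rot i c -> rk y <= rk x by rewrite mem_rot; apply: x_max.
rewrite {}def_c' in rk_le *.
case: c' rk_le => [|a c'] rk_le //; case: (lastP c') rk_le => // {}c' b rk_le _.
case/andP => /=; rewrite rcons_path last_rcons.
case/andP => Txa /andP[_ Tbx] /and3P[_ ].
rewrite mem_rcons inE negb_or => /andP[/eqP neq_ab _] _; case: neq_ab.
apply: (uniq_down x) => //; first by rewrite adj_sym.
  by apply: rk_le; rewrite !inE eqxx orbT.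
by apply: rk_le; rewrite !(inE, mem_rcons) eqxx !orbT.
Qed.

Section ParentTree.
Variables (I : finType) (r : I) (p : I -> I) (rk : I -> nat).
Hypothesis rk_parent : forall t, t != r -> rk (p t) < rk t.

(** The guards against [r] allow [p] to be a total function with an arbitrary value at the root. *)
Definition parent_adj : rel I := fun s t =>
  (s != r) && (p s == t) || (t != r) && (p t == s).

Lemma parent_adj_sym : symmetric parent_adj.
Proof. by move=> s t; rewrite /parent_adj orbC. Qed.

Lemma parent_adj_irrefl : irreflexive parent_adj.
Proof.
move=> t; rewrite /parent_adj orbb; apply/negP => /andP[/rk_parent + /eqP eq_t].
by rewrite eq_t ltnn.
Qed.

Definition parent_graph : sgraph I := SGraph parent_adj_sym parent_adj_irrefl.

Lemma parent_graph_down t s s' :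
  parent_graph t s -> parent_graph t s' -> rk s <= rk t -> rk s' <= rk t -> s = s'.
Proof.
have down u v : parent_graph u v -> rk v <= rk u -> v = p u.
  by case/orP=> /andP[/rk_parent + /eqP def_v]; rewrite def_v // ltnNge => /negP.
by move=> Tts Tts' le_s le_s'; rewrite (down t s) // (down t s').
Qed.

Lemma parent_graph_is_tree : is_tree parent_graph.
Proof.
apply: (@ranked_is_tree _ _ rk r) parent_graph_down => t t_r.
by exists (p t); rewrite rk_parent //= /parent_adj t_r eqxx.
Qed.

(** Following parents from any member reaches [q] without leaving [Q], so this is connectedness of a
    subtree in a form that can be checked one node at a time. *)
Definition topped (Q : {set I}) (q : I) : Prop :=
  q \in Q /\ forall t, t \in Q -> t != q -> (t != r) && (p t \in Q).

Lemma topped_root (Q : {set I}) q : topped Q q -> r \in Q -> q = r.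
Proof.
case=> _ up Qr; apply/eqP; rewrite eq_sym; apply/negPn/negP => /(up _ Qr).
by rewrite eqxx.
Qed.

Lemma topped_is_tree (Q : {set I}) q : topped Q q -> is_tree (induced parent_graph Q).
Proof.
case=> Qq up; apply: (@ranked_is_tree _ _ (rk \o val) (Sub q Qq)).
  move=> [t Qt]; rewrite -val_eqE /= => /(up t Qt)/andP[t_r Qpt].
  by exists (Sub (p t) Qpt); rewrite /= rk_parent // andbT /induced_adj /= /parent_adj t_r eqxx.
move=> t s s' Tts Tts' le_s le_s'; apply: val_inj.
exact: (@parent_graph_down (val t)).
Qed.

End ParentTree.

(** * Decompositions of a quotient, expressed on the original vertices *)

(** When [e] is an equivalence, these are the nodes whose bag, after passing to the quotient,
    contains the class of [x]. *)
Definition touching (V I : finType) (e : rel V) (B : I -> {set V}) (x : V) : {set I} :=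
  [set t | [exists y, e x y && (y \in B t)]].

Lemma touchingP (V I : finType) (e : rel V) (B : I -> {set V}) (x : V) (t : I) :
  reflect (exists2 y, e x y & y \in B t) (t \in touching e B x).
Proof.
rewrite inE; apply: (iffP existsP) => [[y /andP[]]|[y exy yB]]; exists y => //.
by rewrite exy.
Qed.

(* [A] is the set of colours whose classes are active. The bags containing a
   vertex form a subtree only after passing to the quotient by [e], and [l t]
   witnesses that the bag at [t] meets at most [k] classes. *)
Record quotient_decomposition (k : nat) (V : finType) (G : sgraph V)
    (c : V -> 'I_k) (A : {set 'I_k}) (e : rel V) (I : finType) (r : I)
    (p : I -> I) (rk : I -> nat) (B : I -> {set V}) (l : I -> V -> 'I_k) : Prop :=
  QuotientDecomposition {
    qd_refl : reflexive e;
    qd_sym : symmetric e;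
    qd_trans : transitive e;
    qd_rank : forall t, t != r -> rk (p t) < rk t;
    qd_active : forall x y, c x = c y -> c x \in A -> e x y;
    qd_class : forall x y, e x y ->
      [\/ x = y, c x = c y /\ c x \in A
        | [/\ c x \notin A, c y \notin A & exists z, G x z && G y z]];
    qd_root : forall x, c x \in A -> x \in B r;
    qd_subtree : forall x, exists q, topped r p (touching e B x) q;
    qd_edge : forall x y, G x y -> exists t, (x \in B t) && (y \in B t);
    qd_label : forall t x y, x \in B t -> y \in B t -> l t x = l t y -> e x y }.

Definition quotient_decomposable (k : nat) (V : finType) (G : sgraph V)
    (c : V -> 'I_k) (A : {set 'I_k}) : Prop :=
  exists e I r p rk B l, @quotient_decomposition k V G c A e I r p rk B l.

Section Merge.
Variables (k : nat) (V : finType) (c : V -> 'I_k) (A : {set 'I_k}) (e : rel V).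

(** Unions and recolourings can enlarge active classes; [merge] performs the identifications that
    this forces. *)
Definition merge : rel V := fun x y => (c x == c y) && (c x \in A) || e x y.

Hypothesis e_active : forall x y, e x y -> c x \in A -> c x = c y.
Hypothesis e_sym : symmetric e.

Lemma merge_sym : symmetric merge.
Proof.
by move=> x y; rewrite /merge e_sym eq_sym; case: eqP => //= ->.
Qed.

Lemma merge_colour x y : merge x y -> c x \in A -> c x = c y.
Proof. by case/orP=> [/andP[/eqP]|/e_active] //; apply. Qed.

Lemma merge_inactive x y : merge x y -> c x \notin A -> e x y.
Proof. by case/orP=> [/andP[_ ->]|]. Qed.

(** Activity is constant along [merge]: a chain either stays in one active colour class or consists
    of inactive vertices related by [e] alone. *)
Lemma merge_trans : transitive e -> transitive merge.
Proof.
move=> e_trans y x z mxy myz; have [Ax|nAx] := boolP (c x \in A).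
  have eq_xy := merge_colour mxy Ax; rewrite eq_xy in Ax.
  by rewrite /merge eq_xy (merge_colour myz Ax) eqxx -(merge_colour myz Ax) Ax.
have exy := merge_inactive mxy nAx.
have nAy : c y \notin A.
  apply: contra nAx => Ay; rewrite e_sym in exy.
  by rewrite -(e_active exy Ay).
by rewrite /merge (e_trans _ _ _ exy (merge_inactive myz nAy)) orbT.
Qed.

End Merge.

Lemma qd_active_colour k V G c A e I r p rk B l :
  @quotient_decomposition k V G c A e I r p rk B l ->
  forall x y, e x y -> c x \in A -> c x = c y.
Proof.
by move=> D x y /(qd_class D)[->|[->]|[/negbTE-> _ _]].
Qed.

(** An active vertex lies in the root bag, and a topped set containing the root has the root as its
    top. Subtrees of active classes thus share [r], so their unions are again subtrees. *)
Lemma qd_active_subtree k V G c A e I r p rk B l :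
  @quotient_decomposition k V G c A e I r p rk B l ->
  forall x, c x \in A -> topped r p (touching e B x) r.
Proof.
move=> D x Ax; have [q top_q] := qd_subtree D x.
rewrite -{2}(topped_root top_q) //; apply/touchingP; exists x.
  exact: qd_refl D x.
exact: qd_root D x Ax.
Qed.

(** * Quotient decompositions along the cliquewidth operations *)

Lemma quotient_decomposable_small (k : nat) (V : finType) (G : sgraph V)
    (c : V -> 'I_k) (A : {set 'I_k}) : #|V| <= 1 -> quotient_decomposable G c A.
Proof.
move=> V_le1; have eqV (x y : V) : x = y by by apply: (fintype_le1P V_le1).
exists eq_op, unit, tt, id, (fun=> 0), (fun=> setT), (fun=> c).
split=> //.
- by move=> y x z /eqP->.
- by move=> x y _ _; apply/eqP; apply: eqV.
- by move=> x y _; constructor 1; apply: eqV.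
- move=> x; exists tt; split=> [|[] //].
  by apply/touchingP; exists x.
- by move=> x y; exists tt; rewrite !inE.
- by move=> t x y _ _ _; apply/eqP; apply: eqV.
Qed.

(** The colours [i] and [j] are about to receive edges, so they count as active before the join. The
    decomposition is kept unchanged: the root bag already contains both ends of every new edge, and
    a class that stops being active has just acquired a common neighbour. *)
Lemma quotient_decomposable_join (k : nat) (V : finType) (G G' : sgraph V)
    (c : V -> 'I_k) (i j : 'I_k) (A : {set 'I_k}) :
  proper_spanning_subgraph G' G ->
  (forall u v, G u v = [|| G' u v, (c u == i) && (c v == j)
                                 | (c u == j) && (c v == i)]) ->
  quotient_decomposable G' c (i |: (j |: A)) -> quotient_decomposable G c A.
Proof.
move=> [sub [u0 [v0 /andP[Guv nG'uv]]]] def_G [e [I [r [p [rk [B [l D]]]]]]].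
(* Properness provides an edge that is really added, hence a vertex of each of the two colours. *)
have [ui [vj [c_ui c_vj]]] : exists ui vj, c ui = i /\ c vj = j.
  move: Guv; rewrite def_G (negbTE nG'uv) /=.
  by case/orP=> /andP[/eqP ? /eqP ?]; [exists u0, v0 | exists v0, u0].
exists e, I, r, p, rk, B, l; case: (D) => *; split=> //.
- by move=> x y eq_c Ax; apply: (qd_active D) => //; rewrite !inE Ax !orbT.
- move=> x y /(qd_class D)[->|[eq_c]|[]]; first by constructor 1.
    have [Ax _|nAx] := boolP (c x \in A); first by constructor 2.
    rewrite !inE (negbTE nAx) orbF => ij_x; constructor 3; rewrite -eq_c; split=> //.
    (* The join makes [vj] adjacent to all of colour [i], and [ui] to all of colour [j]. *)
    case/orP: ij_x => /eqP c_x; [exists vj | exists ui].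
      by rewrite !def_G -eq_c c_x c_vj !eqxx /= !orbT.
    by rewrite !def_G -eq_c c_x c_ui !eqxx /= !orbT.
  rewrite !inE !negb_or => /and3P[_ _ nAx] /and3P[_ _ nAy] [z /andP[xz yz]].
  by constructor 3; split=> //; exists z; rewrite !sub.
- by move=> x Ax; apply: (qd_root D); rewrite !inE Ax !orbT.
- move=> x y; rewrite def_G => /or3P[/(qd_edge D) //||] /andP[/eqP cx /eqP cy];
    by exists r; rewrite !(qd_root D) // !inE ?cx ?cy eqxx ?orbT.
Qed.

(** A colour is active beforehand exactly when its image is active afterwards, whence the preimage
    of [A]. The bags stay, and active classes that receive the same colour are merged. *)
Lemma quotient_decomposable_recolour (k : nat) (V : finType) (G : sgraph V)
    (c c' : V -> 'I_k) (f : 'I_k -> 'I_k) (A : {set 'I_k}) :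
  (forall v, c v = f (c' v)) ->
  quotient_decomposable G c' (f @^-1: A) -> quotient_decomposable G c A.
Proof.
move=> def_c [e [I [r [p [rk [B [l D]]]]]]].
have active x : (c' x \in f @^-1: A) = (c x \in A) by rewrite inE def_c.
have eA x y : e x y -> c x \in A -> c x = c y.
  by rewrite -active !def_c => exy Ax; rewrite (qd_active_colour D exy Ax).
have e_sym := qd_sym D.
exists (merge c A e), I, r, p, rk, B, l; split.
- by move=> x; rewrite /merge (qd_refl D) orbT.
- exact: merge_sym.
- exact: merge_trans (qd_trans D).
- exact: qd_rank D.
- by move=> x y eq_c Ax; rewrite /merge eq_c eqxx -eq_c Ax.
- move=> x y /orP[/andP[/eqP eq_c Ax]|]; first by constructor 2.
  case/(qd_class D)=> [->|[eq_c Ax]|]; first by constructor 1.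
    by constructor 2; rewrite -active Ax !def_c eq_c.
  by rewrite !active; constructor 3.
- by move=> x Ax; apply: (qd_root D); rewrite active.
- move=> x; have [Ax|nAx] := boolP (c x \in A).
    exists r; split.
      apply/touchingP; exists x; first by rewrite /merge eqxx Ax.
      by apply: (qd_root D); rewrite active.
    (* The bag at [t] meets the merged class in some [y] that was active already, so the old subtree
       of [y] is topped by [r] and contains the parent of [t]. *)
    move=> t /touchingP[y mxy yBt] t_r; have eq_c := merge_colour eA mxy Ax.
    have Ay : c' y \in f @^-1: A by rewrite active -eq_c.
    have [_ up] := qd_active_subtree D Ay.
    have: t \in touching e B y by apply/touchingP; exists y; rewrite ?(qd_refl D).
    case/up/(_ t_r)/andP => _ /touchingP[z eyz zB].
    rewrite t_r; apply/touchingP; exists z => //.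
    by apply: merge_trans mxy _ => //; [exact: qd_trans D | rewrite /merge eyz orbT].
  have [q top_q] := qd_subtree D x; exists q.
  suff ->: touching (merge c A e) B x = touching e B x by [].
  by apply/setP=> t; rewrite !inE; apply: eq_existsb => y; rewrite /merge (negbTE nAx) andbF.
- exact: qd_edge D.
- by move=> t x y xB yB /(qd_label D xB yB); rewrite /merge => ->; rewrite orbT.
Qed.

Lemma quotient_decomposable_iso (k : nat) (V W : finType) (G : sgraph V)
    (H : sgraph W) (h : V -> W) (c : V -> 'I_k) (d : W -> 'I_k) (A : {set 'I_k}) :
  graph_iso G H h -> (forall x, d (h x) = c x) ->
  quotient_decomposable G c A -> quotient_decomposable H d A.
Proof.
move=> [[g hK gK] h_adj] d_h [e [I [r [p [rk [B [l D]]]]]]].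
have c_g y : c (g y) = d y by rewrite -d_h gK.
have g_adj x y : G (g x) (g y) = H x y by rewrite -h_adj !gK.
exists (relpre g e), I, r, p, rk, (fun t => g @^-1: B t), (fun t => l t \o g).
have touch_g x : touching (relpre g e) (fun t => g @^-1: B t) x = touching e B (g x).
  apply/setP=> t; apply/touchingP/touchingP => [[y exy]|[y exy yB]].
    by rewrite inE; exists (g y).
  by exists (h y); rewrite /= ?inE hK.
split.
- by move=> x; apply: qd_refl D _.
- by move=> x y; apply: qd_sym D _ _.
- by move=> y x z; apply: qd_trans D _ _ _.
- exact: qd_rank D.
- by move=> x y; rewrite -!c_g; apply: qd_active D _ _.
- move=> x y /(qd_class D); rewrite !c_g.
  case=> [eq_g|?|[nAx nAy [z /andP[xz yz]]]]; last 1 first.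
  + by constructor 3; split=> //; exists (h z); rewrite -!g_adj hK xz.
  + by constructor 1; apply: (can_inj gK).
  + by constructor 2.
- by move=> x; rewrite -c_g inE; apply: qd_root D _.
- by move=> x; rewrite touch_g; apply: qd_subtree D _.
- by move=> x y; rewrite -g_adj => /(qd_edge D)[t]; exists t; rewrite !inE.
- by move=> t x y; rewrite !inE; apply: qd_label D _ _ _.
Qed.

(** A new root above the two old ones receives all active vertices, labelled by their colours.
    Equally coloured active classes of the two sides are identified, and their subtrees are joined
    through this root. *)
Lemma quotient_decomposable_dunion (k : nat) (V1 V2 : finType) (G1 : sgraph V1)
    (G2 : sgraph V2) (c : V1 + V2 -> 'I_k) (A : {set 'I_k}) :
  quotient_decomposable G1 (c \o inl) A -> quotient_decomposable G2 (c \o inr) A ->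
  quotient_decomposable (dunion G1 G2) c A.
Proof.
move=> [e1 [I1 [r1 [p1 [rk1 [B1 [l1 D1]]]]]]] [e2 [I2 [r2 [p2 [rk2 [B2 [l2 D2]]]]]]].
pose e0 (x y : V1 + V2) : bool := match x, y with
  | inl a, inl b => e1 a b | inr a, inr b => e2 a b | _, _ => false end.
have e0_active x y : e0 x y -> c x \in A -> c x = c y.
  case: x y => [a|a] [b|b] //=; first exact: (qd_active_colour D1).
  exact: (qd_active_colour D2).
have e0_refl : reflexive e0.
  by case=> a /=; rewrite ?(qd_refl D1) ?(qd_refl D2).
have e0_sym : symmetric e0.
  by move=> [a|a] [b|b] //=; [exact: qd_sym D1 _ _ | exact: qd_sym D2 _ _].
have e0_trans : transitive e0.
  move=> [b|b] [a|a] [d|d] //=; first exact: qd_trans D1 _ _ _.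
  exact: qd_trans D2 _ _ _.
(* [None] is the new root, with itself as a dummy parent; ranks are shifted by one to make room for
   it. *)
pose p (t : option (I1 + I2)) := match t with
  | Some (inl s) => if s == r1 then None else Some (inl (p1 s))
  | Some (inr s) => if s == r2 then None else Some (inr (p2 s))
  | None => None end.
pose rk (t : option (I1 + I2)) := match t with
  | Some (inl s) => (rk1 s).+1 | Some (inr s) => (rk2 s).+1 | None => 0 end.
pose B (t : option (I1 + I2)) : {set V1 + V2} := match t with
  | Some (inl s) => inl @: B1 s | Some (inr s) => inr @: B2 s
  | None => [set x | c x \in A] end.
(* The default [c x] is the label that matters at the root; the mixed cases never occur in a bag. *)
pose l (t : option (I1 + I2)) (x : V1 + V2) := match t, x with
  | Some (inl s), inl a => l1 s a | Some (inr s), inr a => l2 s a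
  | _, _ => c x end.
have inl_inj : injective (@inl V1 V2) by move=> ? ? [].
have inr_inj : injective (@inr V1 V2) by move=> ? ? [].
exists (merge c A e0), _, None, p, rk, B, l; split.
- by move=> x; rewrite /merge e0_refl orbT.
- exact: merge_sym.
- exact: merge_trans.
- move=> [[t|t]|] //= _; case: eqP => //= /eqP; rewrite ltnS.
    exact: qd_rank D1 _.
  exact: qd_rank D2 _.
- by move=> x y eq_c Ax; rewrite /merge eq_c eqxx -eq_c Ax.
- move=> x y /orP[/andP[/eqP eq_c Ax]|]; first by constructor 2.
  case: x y => [a|a] [b|b] //=.
    case/(qd_class D1)=> [->|?|[nAx nAy [z]]]; [by constructor 1|by constructor 2|].
    by constructor 3; split=> //; exists (inl z).
  case/(qd_class D2)=> [->|?|[nAx nAy [z]]]; [by constructor 1|by constructor 2|].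
  by constructor 3; split=> //; exists (inr z).
- by move=> x Ax; rewrite inE.
- move=> x; have [Ax|nAx] := boolP (c x \in A).
    exists None; have rootx : None \in touching (merge c A e0) B x.
      by apply/touchingP; exists x; rewrite ?inE // /merge e0_refl orbT.
    split=> // t /touchingP[y mxy yB] t_r; rewrite t_r /=.
    have eq_c := merge_colour e0_active mxy Ax.
    case: t yB {t_r} => [[t|t]|] //= /imsetP[b bB def_y].
    (* The old root [r1] has the new root as parent. Any other node inherits its parent from the
       subtree of [b], which is topped by [r1] because [b] is active. *)
    + case: eqP => // /eqP t_r1.
      have Ab : (c \o inl) b \in A by rewrite /= -def_y -eq_c.
      have [_ up] := qd_active_subtree D1 Ab.
      have: t \in touching e1 B1 b by apply/touchingP; exists b; rewrite ?(qd_refl D1).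
      case/up/(_ t_r1)/andP => _ /touchingP[z ebz zB].
      apply/touchingP; exists (inl z); last exact: imset_f.
      by apply: merge_trans mxy _ => //; rewrite def_y /merge /= ebz orbT.
    + case: eqP => // /eqP t_r2.
      have Ab : (c \o inr) b \in A by rewrite /= -def_y -eq_c.
      have [_ up] := qd_active_subtree D2 Ab.
      have: t \in touching e2 B2 b by apply/touchingP; exists b; rewrite ?(qd_refl D2).
      case/up/(_ t_r2)/andP => _ /touchingP[z ebz zB].
      apply/touchingP; exists (inr z); last exact: imset_f.
      by apply: merge_trans mxy _ => //; rewrite def_y /merge /= ebz orbT.
  (* The class of an inactive vertex contains no active one, so it misses the root bag and keeps the
     subtree it had on its own side. *)
  have not_root : None \notin touching (merge c A e0) B x.
    apply/touchingP=> -[y mxy]; rewrite inE => Ay; case/negP: nAx.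
    rewrite merge_sym // in mxy.
    by rewrite -(merge_colour e0_active mxy Ay).
  case: x nAx not_root => a nAx not_root.
    have touch1 t : (Some (inl t) \in touching (merge c A e0) B (inl a)) =
        (t \in touching e1 B1 a).
      apply/touchingP/touchingP=> [[y /merge_inactive/(_ nAx) + /imsetP[b bB def_y]]|[b eab bB]].
        by rewrite def_y; exists b.
      by exists (inl b); [rewrite /merge /= eab orbT | exact: imset_f].
    have [q [Qq up]] := qd_subtree D1 a; exists (Some (inl q)); split.
      by rewrite touch1.
    move=> [[t|t]|]; last by rewrite (negbTE not_root).
      rewrite touch1 => Qt neq_t; case/andP: (up t Qt neq_t) => t_r Qpt.
      by rewrite /= (negbTE t_r) touch1.
    by case/touchingP=> y /merge_inactive/(_ nAx) + /imsetP[b _ def_y]; rewrite def_y.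
  have touch2 t : (Some (inr t) \in touching (merge c A e0) B (inr a)) =
      (t \in touching e2 B2 a).
    apply/touchingP/touchingP=> [[y /merge_inactive/(_ nAx) + /imsetP[b bB def_y]]|[b eab bB]].
      by rewrite def_y; exists b.
    by exists (inr b); [rewrite /merge /= eab orbT | exact: imset_f].
  have [q [Qq up]] := qd_subtree D2 a; exists (Some (inr q)); split.
    by rewrite touch2.
  move=> [[t|t]|]; last by rewrite (negbTE not_root).
    by case/touchingP=> y /merge_inactive/(_ nAx) + /imsetP[b _ def_y]; rewrite def_y.
  rewrite touch2 => Qt neq_t; case/andP: (up t Qt neq_t) => t_r Qpt.
  by rewrite /= (negbTE t_r) touch2.
- move=> [a|a] [b|b] //= => [/(qd_edge D1)|/(qd_edge D2)] [t /andP[aB bB]].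
    by exists (Some (inl t)); rewrite !imset_f.
  by exists (Some (inr t)); rewrite !imset_f.
- move=> [[t|t]|] x y.
  + move=> /imsetP[a aB ->] /imsetP[b bB ->] /= /(qd_label D1 aB bB) eab.
    by rewrite /merge /= eab orbT.
  + move=> /imsetP[a aB ->] /imsetP[b bB ->] /= /(qd_label D2 aB bB) eab.
    by rewrite /merge /= eab orbT.
  + by rewrite !inE /= => Ax _ eq_c; rewrite /merge eq_c eqxx -eq_c Ax.
Qed.

(** The set [A] encodes the future of the construction, so the induction must allow every [A]: each
    operation asks its predecessor for a different active set. *)
Lemma cliquewidth_quotient_decomposable (k : nat) (V : finType) (G : sgraph V)
    (c : V -> 'I_k) (A : {set 'I_k}) :
  cliquewidth_pair G c -> quotient_decomposable G c A.
Proof.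
move=> cwG; elim: cwG A => {V G c}
  [V G c V_le1|V V1 V2 G c G1 c1 G2 c2 h _ IH1 _ IH2 _ _ iso_h c_inl c_inr
  |V G c c' i j _ _ IH _ _ def_c|V G G' c i j _ _ IH proper_G' def_G] A.
- exact: quotient_decomposable_small.
- apply: (@quotient_decomposable_iso _ _ _ _ _ h (c \o h)) iso_h _ _ => //.
  apply: quotient_decomposable_dunion.
    by rewrite (_ : _ \o inl = c1) //; apply/funext.
  by rewrite (_ : _ \o inr = c2) //; apply/funext.
- exact: (quotient_decomposable_recolour (f := fun a => if a == i then j else a)) def_c (IH _).
- exact: quotient_decomposable_join proper_G' def_G (IH _).
Qed.

(** * Distances and the quasi-isometry to the quotient graph *)

Lemma dist_walk (R : realType) (V : finType) (G : sgraph V) (x : V) (q : seq V) :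
  path G x q -> (dist R G x (last x q) <= ((size q)%:R)%:E)%E.
Proof.
move=> /shortenP[q' Gq' uniq_q' sub_q'].
have le_size : size q' <= size q.
  by apply: uniq_leq_size => //; case/andP: uniq_q'.
have Gsize : has_path_of_length G x (last x q') (size q').
  by apply/existsP; exists (in_tuple q'); rewrite /is_path Gq' eqxx.
rewrite /dist; case: pselect => [ex_n|[]]; last by exists (size q').
rewrite lee_fin ler_nat; case: ex_minnP => m _ m_min.
exact: leq_trans (m_min _ Gsize) le_size.
Qed.

(** Distances are handled through walks, which, unlike paths, survive concatenation and projection
    to the quotient. *)
Variant dist_spec (R : realType) (V : finType) (G : sgraph V) (x y : V) :
    \bar R -> Prop :=
| DistInfty : dist_spec G x y +oo%E
| DistWalk q : path G x q -> last x q = y -> dist_spec G x y ((size q)%:R)%:E.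

Lemma distP (R : realType) (V : finType) (G : sgraph V) (x y : V) :
  dist_spec G x y (dist R G x y).
Proof.
rewrite /dist; case: pselect => [ex_n|_]; last exact: DistInfty.
case: ex_minnP => m /existsP[q /and3P[Gq /eqP last_q _]] _.
by rewrite -{1}(size_tuple q); apply: DistWalk.
Qed.

Section QuotientGraph.
Variables (V W : finType) (G : sgraph V) (f : V -> W).

Definition quotient_adj : rel W := fun a b =>
  (a != b) && [exists x, exists y, [&& f x == a, f y == b & G x y]].

Lemma quotient_adj_sym : symmetric quotient_adj.
Proof.
move=> a b; rewrite /quotient_adj eq_sym; congr (_ && _).
by apply/existsP/existsP => -[x /existsP[y /and3P[fx fy Gxy]]];
  exists y; apply/existsP; exists x; rewrite fx fy adj_sym.
Qed.

Lemma quotient_adj_irrefl : irreflexive quotient_adj.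
Proof. by move=> a; rewrite /quotient_adj eqxx. Qed.

Definition quotient_graph : sgraph W := SGraph quotient_adj_sym quotient_adj_irrefl.

(** Edges inside a fibre collapse and all others project to edges. *)
Lemma quotient_walk x q :
  path G x q -> exists2 q', path quotient_graph (f x) q' &
    last (f x) q' = f (last x q) /\ size q' <= size q.
Proof.
elim: q x => [|y q IHq] x /=; first by exists [::].
case/andP=> Gxy /IHq[q' Gq' [last_q' le_q']].
have [eq_f|neq_f] := eqVneq (f x) (f y).
  by exists q'; rewrite eq_f // last_q' ltnW.
exists (f y :: q') => //=; rewrite Gq' andbT /quotient_adj neq_f.
by apply/existsP; exists x; apply/existsP; exists y; rewrite !eqxx.
Qed.

Hypothesis fibre : forall x y, f x = f y -> x = y \/ exists z, G x z && G y z.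

(** Each edge lifts to one edge, and at most two steps are spent inside each of the [size q + 1]
    fibres visited, giving [size q + 2 * (size q + 1)]. *)
Lemma lift_walk x q y :
  path quotient_graph (f x) q -> last (f x) q = f y -> exists2 q', path G x q' &
    last x q' = y /\ size q' <= 3 * size q + 2.
Proof.
have short u v : f u = f v -> exists2 q', path G u q' & last u q' = v /\ size q' <= 2.
  case/fibre=> [->|[z /andP[Guz Gvz]]]; first by exists [::].
  by exists [:: z; v] => //=; rewrite Guz adj_sym Gvz.
elim: q x => [|w q IHq] x /=; first by move=> _; apply: short.
case/andP=> /andP[_ /existsP[u /existsP[v /and3P[/eqP fu /eqP fv Guv]]]].
rewrite -fv => /IHq{}IHq /IHq[q2 Gq2 [last_q2 le_q2]].
have [q1 Gq1 [last_q1 le_q1]] := short _ _ (esym fu).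
exists (q1 ++ v :: q2); first by rewrite cat_path Gq1 last_q1 /= Guv.
rewrite last_cat /= size_cat /= mulnS; split=> //.
by rewrite addnS -addSn -addnA leq_add.
Qed.

(** Projection never increases distance, and lifting bounds a distance [n] in the quotient by
    [3n + 2] in [G]; both are within the constant 3. Surjectivity of [f] gives (QI2) at distance
    0. *)
Lemma quotient_quasi_isometry (R : realType) :
  (forall w, exists x, f x = w) -> quasi_isometry (3%:R : R) G quotient_graph f.
Proof.
move=> f_surj; split=> [x y|w]; last first.
  have [x <-] := f_surj w; exists x.
  by apply: le_trans (dist_walk R (_ : path _ (f x) [::])) _; rewrite ?lee_fin.
split.
  case: (distP R quotient_graph (f x) (f y)) => [|q Hq]; first exact: leey.
  move=> /(lift_walk Hq)[q' Gq' [last_q' le_q']].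
  have := dist_walk R Gq'; rewrite last_q'.
  case: (distP R G x y) => [|q0 _ _]; first by rewrite leye_eq.
  rewrite lee_fin -EFinM -EFinB lee_fin ler_nat => le_q0.
  have: ((size q0)%:R <= (3 * size q + 2)%:R :> R)%R by rewrite ler_nat (leq_trans le_q0).
  rewrite natrD natrM => le; lra.
case: (distP R G x y) => [|q Gq <-].
  by rewrite mulry gtr0_sg ?mul1e ?addye ?leey.
have [q' Hq' [<- le_q']] := quotient_walk Gq.
apply: le_trans (dist_walk R Hq') _; rewrite -EFinM -EFinD lee_fin.
have: ((size q')%:R <= (size q)%:R :> R)%R by rewrite ler_nat.
have: (0 <= (size q)%:R :> R)%R by [].
move=> ge0 le; lra.
Qed.

End QuotientGraph.

(** * Treewidth of the quotient graph and conclusion *)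

Lemma treewidth_le (V I : finType) (G : sgraph V) (T : sgraph I)
    (B : I -> {set V}) (k : nat) :
  tree_decomposition G T B -> (forall t, #|B t| <= k) -> (treewidth G <= k%:Z - 1)%R.
Proof.
move=> TD B_le; rewrite /treewidth lerD2r lez_nat.
case: ex_minnP => m _ m_min; apply: (@leq_trans (max_bag_size B)); last exact/bigmax_leqP.
by apply: m_min; apply/asboolP; exists I, T, B.
Qed.

(** On [D] the map [f] factors through [l]. The map [g] realises this factor, with [None] at labels
    that are not attained. *)
Lemma card_imset_le_label (V W L : finType) (D : {set V}) (f : V -> W) (l : V -> L) :
  {in D &, forall x y, l x = l y -> f x = f y} -> #|f @: D| <= #|L|.
Proof.
move=> lf; pose g j := omap f [pick x in D | l x == j].
have some_inj : injective (@Some W) by move=> ? ? [].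
rewrite -(card_imset _ some_inj).
apply: leq_trans (leq_imset_card g predT); apply/subset_leq_card/subsetP.
move=> _ /imsetP[_ /imsetP[x Dx ->] ->]; apply/imsetP; exists (l x) => //.
rewrite /g; case: pickP => [y /andP[Dy /eqP eq_l]|/(_ x)]; last by rewrite Dx eqxx.
by rewrite /= (lf y x).
Qed.

(** The images of the bags under [f] form the tree-decomposition: the nodes holding [f x] are those
    touching the class of [x], and the labels bound each image by [k]. *)
Lemma quotient_treewidth (k : nat) (V W : finType) (G : sgraph V) (c : V -> 'I_k)
    (A : {set 'I_k}) e (I : finType) (r : I) p rk B l (f : V -> W) :
  quotient_decomposition G c A e r p rk B l ->
  (forall w, exists x, f x = w) -> (forall x y, (f x == f y) = e x y) ->
  (treewidth (quotient_graph G f) <= k%:Z - 1)%R.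
Proof.
move=> D f_surj ker_f; pose T := parent_graph (qd_rank D).
apply: (@treewidth_le _ _ _ T (fun t => f @: B t)); last first.
  move=> t; rewrite -[leqRHS]card_ord; apply: (@card_imset_le_label _ _ _ _ _ (l t)).
  by move=> x y xB yB eq_l; apply/eqP; rewrite ker_f (qd_label D xB yB).
split.
- exact: parent_graph_is_tree.
- move=> w; have [x <-] := f_surj w; have [q top_q] := qd_subtree D x.
  suff ->: [set t | f x \in f @: B t] = touching e B x by apply: topped_is_tree top_q.
  apply/setP=> t; rewrite inE; apply/imsetP/touchingP=> -[y].
    by move=> yB /eqP; rewrite ker_f; exists y.
  by rewrite -ker_f => /eqP ? ?; exists y.
- move=> a b /andP[_ /existsP[x /existsP[y /and3P[/eqP<- /eqP<- Gxy]]]].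
  by have [t /andP[xB yB]] := qd_edge D Gxy; exists t; rewrite !imset_f.
Qed.

Lemma equivalence_quotient (V : finType) (e : rel V) :
  reflexive e -> symmetric e -> transitive e ->
  exists (W : finType) (f : V -> W),
    (forall w, exists x, f x = w) /\ (forall x y, (f x == f y) = e x y).
Proof.
move=> e_refl e_sym e_trans; pose cls x := [set y | e x y].
have clsP x y : (cls x == cls y) = e x y.
  apply/eqP/idP=> [/setP/(_ y)|exy]; first by rewrite !inE e_refl.
  by apply/setP=> z; rewrite !inE; apply/idP/idP; apply: e_trans; rewrite // e_sym.
have mem_cls x : cls x \in cls @: setT by exact: imset_f.
exists {C : {set V} | C \in cls @: setT}, (fun x => Sub (cls x) (mem_cls x)).
split=> [[C clsC]|x y]; last by rewrite -val_eqE /= clsP.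
by have /imsetP[x _ def_C] := clsC; exists x; apply: val_inj.
Qed.

Theorem theorem1 (R : realType) (k : nat) (hk : (1 <= k)%N)
    (V : finType) (G : sgraph V) (hG : (cliquewidth G <= k)%N) :
  exists (W : finType) (H : sgraph W),
    (treewidth H <= k%:Z - 1)%R /\ quasi_isometric (3%:R : R)%R G H.
Proof.
move: hG; rewrite /cliquewidth; case: ex_minnP => k' /asboolP[c cwG] _ le_k'k.
(* No edges follow the last operation, so no colour is active. With [set0], [qd_class] leaves only
   equality or a common neighbour, which is the fibre condition for the quasi-isometry. *)
have [e [I [r [p [rk [B [l D]]]]]]] := cliquewidth_quotient_decomposable set0 cwG.
have [W [f [f_surj ker_f]]] :=
  equivalence_quotient (qd_refl D) (qd_sym D) (qd_trans D).
exists W, (quotient_graph G f); split.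
  apply: le_trans (quotient_treewidth D f_surj ker_f) _.
  by rewrite lerD2r lez_nat.
exists f; apply: quotient_quasi_isometry => // x y /eqP; rewrite ker_f.
case/(qd_class D)=> [|[_]|[_ _]]; first by left.
  by rewrite inE.
by right.
Qed.
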